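(* There exist absolute constants $C>0$ and $c>0$ such that for every prime power $q$ and all sets $A,B,D\subset M_2(\mathbb{F}_q)$ with $|A||B||D|\ge C\,q^{11}$, the set $\{a(b+d): a\in A,\ b\in B,\ d\in D\}$ has at least $c\,q^4$ elements.
   Context: $\mathbb{F}_q$ is the finite field with $q$ elements and $M_2(\mathbb{F}_q)$ is the ring of $2\times 2$ matrices over $\mathbb{F}_q$. *)

(* Defs.v *)
From HB Require Import structures.
From mathcomp Require Import all_boot all_order all_algebra.
From mathcomp Require Import reals.

Set Implicit Arguments.
Unset Strict Implicit.
Unset Printing Implicit Defensive.

Import Order.TTheory GRing.Theory Num.Theory.
Local Open Scope ring_scope.

Definition mul_sumset (F : finFieldType) (A B D : {set 'M[F]_2}) :
    {set 'M[F]_2} :=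
  [set x | [exists a in A, exists b in B, exists d in D, x == a *m (b + d)]].

(* Main.v *)
(* Singular matrices are only O(q^3), so one may assume A invertible. Let N(s, b)
   be the number of (a, d) in A x D with a (b + d) = s; its mean over all (s, b)
   is mu = |A||D| / q^4. Counting collisions, its total squared deviation from mu
   is at most 2 q^7 |A||D|. If S = A(B + D) had fewer than q^4 / 2 elements, then
   N would exceed mu by a factor 2 on average on S x B, which carries total mass
   |A||B||D|, and Cauchy-Schwarz on S x B would give |A||B||D| <= 8 q^7 |S|. *)
Require Import Defs.
From HB Require Import structures.
From mathcomp Require Import all_boot all_order all_algebra.
From mathcomp Require Import reals.
From mathcomp Require Import ring lra zify.

Set Implicit Arguments.
Unset Strict Implicit.
Unset Printing Implicit Defensive.

Import Order.TTheory GRing.Theory Num.Theory.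
Local Open Scope ring_scope.

(** Cauchy-Schwarz against the constant 1: with [m] the size of [X] and [s] the sum, expanding the
    nonnegative sum of [(m * g i - s) ^+ 2] gives [m] times the difference of the two sides. *)
Lemma sqr_sum_le (R : realFieldType) (I : finType) (X : {pred I}) (g : I -> R) :
  (\sum_(i in X) g i) ^+ 2 <= #|X|%:R * \sum_(i in X) g i ^+ 2.
Proof.
have [X0|X_gt0] := posnP #|X|.
  by rewrite X0 mul0r big_pred0 ?expr0n // => i; rewrite (card0_eq X0).
set s := \sum_(i in X) g i; set m : R := #|X|%:R.
have m_gt0 : 0 < m by rewrite ltr0n.
have : 0 <= \sum_(i in X) (m * g i - s) ^+ 2.
  by apply: sumr_ge0 => i _; apply: sqr_ge0.
under eq_bigr => i _.
  rewrite (_ : _ ^+ 2 = m ^+ 2 * g i ^+ 2 + (s ^+ 2 - 2 * m * s * g i)).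
    over.
  by ring.
rewrite big_split /= sumrB -!mulr_sumr sumr_const -/s -mulr_natl -/m.
set t := \sum_(i in X) _ => h.
have : 0 <= m * (m * t - s ^+ 2) by nra.
by rewrite pmulr_rge0 // subr_ge0.
Qed.

(** The order of GL_2 gives the exact count q^4 - q (q - 1)^2 (q + 1) = q^3 + q^2 - q. *)
Lemma card_singular_mx2 (F : finFieldType) :
  (#|[set a : 'M[F]_2 | a \notin unitmx]| <= 2 * #|F| ^ 3)%N.
Proof.
have cU : #|[set a : 'M[F]_2 | a \in unitmx]| =
    (#|F| * #|F|.-1 ^ 2 * #|F|.+1)%N.
  by rewrite -card_GL_2 cardsT card_sub cardsE.
have := cardsC [set a : 'M[F]_2 | a \in unitmx].
rewrite cU card_mx.
have -> : ~: [set a : 'M[F]_2 | a \in unitmx] = [set a | a \notin unitmx].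
  by apply/setP => a; rewrite !inE.
have := card_finNzRing_gt1 F.
case: #|F| => [//|q] _ /=; move: #|_| => s.
rewrite (_ : 2 * 2 = 4)%N // !expnS !expn0; nia.
Qed.

Section SecondMoment.
Variables (R : realFieldType) (P B S : finType) (f : P -> B -> S) (L : {set P}).

Let N (x : S * B) : R := \sum_(p in L) (f p x.2 == x.1)%:R.

Lemma sum_fiber : \sum_x N x = (#|L| * #|B|)%:R.
Proof.
rewrite exchange_big /= natrM mulr_natl -sumr_const; apply: eq_bigr => p _.
rewrite -(pair_bigA _ (fun s b => (f p b == s)%:R)) /= exchange_big /=.
rewrite -sum1_card natr_sum; apply: eq_bigr => b _.
rewrite (bigD1 (f p b)) //= eqxx big1 ?addr0 // => s.
by rewrite eq_sym => /negPf ->.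
Qed.

(** Squaring a sum of indicators counts ordered pairs [p], [p']; summing over the common value
    leaves the [b] at which they agree. *)
Lemma sum_fiber_sqr :
  \sum_x N x ^+ 2 =
  (\sum_(p in L) \sum_(p' in L) #|[set b | f p b == f p' b]|)%:R.
Proof.
under [LHS]eq_bigr => x _ do rewrite expr2 mulr_suml.
rewrite exchange_big natr_sum /=; apply: eq_bigr => p _.
under [LHS]eq_bigr => x _ do rewrite mulr_sumr.
rewrite exchange_big natr_sum /=; apply: eq_bigr => p' _.
rewrite -(pair_bigA _ (fun s b => (f p b == s)%:R * (f p' b == s)%:R)) /=.
rewrite exchange_big -sum1_card natr_sum [RHS]big_mkcond /=.
apply: eq_bigr => b _; rewrite inE (bigD1 (f p b)) //= eqxx mul1r.
rewrite big1 ?addr0; last by move=> s; rewrite eq_sym => /negPf ->; rewrite mul0r.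
by rewrite eq_sym; case: eqP.
Qed.

(** By [sum_fiber] the subtracted constant is the mean of [N], so the cross term leaves the second
    moment minus the squared mean times the number of points [#|S| * #|B|]. *)
Lemma fiber_variance : (0 < #|S|)%N ->
  \sum_x (N x - #|L|%:R / #|S|%:R) ^+ 2 =
  (\sum_(p in L) \sum_(p' in L) #|[set b | f p b == f p' b]|)%:R
  - #|L|%:R ^+ 2 * #|B|%:R / #|S|%:R.
Proof.
move=> S_gt0; have S_neq0 : #|S|%:R != 0 :> R by rewrite pnatr_eq0 -lt0n.
set mu := _ / _.
under [LHS]eq_bigr => x _.
  rewrite (_ : _ ^+ 2 = N x ^+ 2 + (mu ^+ 2 - 2 * mu * N x)); last by ring.
  over.
rewrite big_split /= sumrB sumr_const -mulr_sumr sum_fiber sum_fiber_sqr.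
rewrite card_prod -mulr_natl !natrM /mu; congr (_ + _).
by field.
Qed.
End SecondMoment.

(* The pairs [(a, d)] and [(a', d')] agree on at most one [b] when [a - a'] is
   invertible. Otherwise, as [a'] is invertible, [b] determines [d']. *)
Lemma collisions_le (F : finFieldType) (A D : {set 'M[F]_2}) :
    {in A, forall a, a \in unitmx} ->
  (\sum_(p in setX A D) \sum_(p' in setX A D)
     #|[set b | p.1 *m (b + p.2) == p'.1 *m (b + p'.2)]|
   <= #|setX A D| * (#|setX A D| + 2 * #|F| ^ 7))%N.
Proof.
move=> unitA; rewrite -[X in (_ <= X * _)%N]sum1_card big_distrl /=.
apply: leq_sum => -[a d] /=; rewrite mul1n => _.
have -> : (\sum_(p' in setX A D) #|[set b | a *m (b + d) == p'.1 *m (b + p'.2)]| =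
    \sum_(a' in A) \sum_(d' in D) #|[set b | a *m (b + d) == a' *m (b + d')]|)%N.
  by rewrite pair_big /=; apply: eq_bigl => -[a' d']; rewrite !inE.
have le_a' a' : a' \in A ->
    (\sum_(d' in D) #|[set b | a *m (b + d) == a' *m (b + d')]|
     <= #|D| + ((a - a')%R \notin unitmx) * #|F| ^ 4)%N.
  move=> Aa'; case: (boolP (a - a' \in unitmx)) => [Ua|_] /=.
    rewrite mul0n addn0 -sum1_card; apply: leq_sum => d' _.
    apply/card_le1_eqP => b b'; rewrite !inE => /eqP eb /eqP eb'.
    apply: (can_inj (mulKmx Ua)); move: eb eb'.
    rewrite !mulmxDr !mulmxBl => eb eb'.
    apply: (addIr (a *m d)).
    by rewrite addrAC eb' addrAC subrr add0r addrAC eb addrAC subrr add0r.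
  apply: leq_trans (leq_addl _ _); rewrite mul1n.
  have -> : (#|F| ^ 4 = \sum_(b : 'M[F]_2) 1)%N by rewrite sum1_card card_mx.
  under eq_bigr do rewrite -sum1_card big_mkcond /=.
  rewrite exchange_big; apply: leq_sum => b _ /=.
  under eq_bigr do rewrite inE.
  rewrite -big_mkcondr sum1dep_card.
  apply/card_le1_eqP => d1 d2; rewrite !inE => /andP[_ /eqP e1] /andP[_ /eqP e2].
  by apply: (addrI b); apply: (can_inj (mulKmx (unitA _ Aa'))); rewrite -e1.
apply: leq_trans; first by apply: leq_sum => a'; exact: le_a'.
rewrite big_split sum_nat_const cardsX leq_add2l -big_distrl /=.
(* At most 2 q^3 values of [a'] make [a - a'] singular, as [a' |-> a - a'] is injective; each of
   them costs at most q^4. *)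
rewrite (expnD _ 3 4) mulnA leq_mul2r; apply/orP; right.
apply: leq_trans (card_singular_mx2 F).
rewrite -big_mkcondr sum1dep_card -(card_imset _ (inj_comp (addrI a) oppr_inj)).
apply/subset_leq_card/subsetP => _ /imsetP[a' + ->].
by rewrite !inE => /andP[].
Qed.

(** Used with [n] = q^4, [l] = |A||D|, [m] the mean, [s] = |S|, [b] = |B| and [Q] = q^7. If
    [2 * s < n], then [n - s] exceeds [n / 2]; dividing the last hypothesis by [w = m * b] bounds
    [l * b = w * n] by [8 * s * Q], against the lower bound [4 * n * Q]. *)
Lemma le_of_second_moment (R : realFieldType) (n l s b Q m : R) :
    m * n = l -> 0 <= s -> 0 < Q -> 4 * n * Q <= l * b ->
    (l * b - s * b * m) ^+ 2 <= s * b * (l * (2 * Q)) ->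
  n <= 2 * s.
Proof.
move=> <- s_ge0 Q_gt0 w_ge h; case: leP => // ltS.
have n_gt0 : 0 < n by lra.
set w := m * b; have w_gt0 : 0 < w.
  suff : 0 < n * w by rewrite pmulr_rgt0.
  apply: lt_le_trans (_ : 4 * n * Q <= _); rewrite ?mulr_gt0 //.
  by move: w_ge; rewrite /w; lra.
have h1 : w * (n - s) ^+ 2 <= s * n * (2 * Q).
  by rewrite -(ler_pM2l w_gt0); move: h; rewrite /w; lra.
have h2 : n ^+ 2 <= 4 * (n - s) ^+ 2 by nra.
have h3 : w * n <= 8 * s * Q.
  rewrite -(ler_pM2l n_gt0).
  have := ler_wpM2l (ltW w_gt0) h2; nra.
suff : 4 * n * Q <= 4 * (2 * s) * Q by rewrite ler_pM2r //; lra.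
by move: w_ge h3; rewrite /w; lra.
Qed.

Lemma card_mul_sumset (F : finFieldType) (A B D : {set 'M[F]_2}) :
    {in A, forall a, a \in unitmx} ->
    (4 * #|F| ^ 11 <= #|A| * #|B| * #|D|)%N ->
  (#|F| ^ 4 <= 2 * #|mul_sumset A B D|)%N.
Proof.
move=> unitA hABD; set S := mul_sumset A B D.
set L := setX A D.
have q_gt0 : (0 < #|F|)%N by rewrite ltnW ?card_finNzRing_gt1.
have n_gt0 : (0 < #|{: 'M[F]_2}|)%N by rewrite card_mx expn_gt0 q_gt0.
pose g (p : 'M[F]_2 * 'M[F]_2) (b : 'M[F]_2) := p.1 *m (b + p.2).
pose N (x : 'M[F]_2 * 'M[F]_2) : rat := \sum_(p in L) (g p x.2 == x.1)%:R.
pose mu : rat := #|L|%:R / #|{: 'M[F]_2}|%:R.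
have muE : mu * (#|F| ^ 4)%:R = #|L|%:R.
  by rewrite /mu card_mx divfK // pnatr_eq0 -lt0n expn_gt0 q_gt0.
(* Here [b] and the product both range over the whole matrix ring, so the subtracted term is exactly
   [#|L| ^ 2] and cancels the main term of [collisions_le]. *)
have var : \sum_x (N x - mu) ^+ 2 <= #|L|%:R * (2 * #|F| ^ 7)%:R.
  rewrite (fiber_variance rat g L n_gt0) mulfK ?pnatr_eq0 -?lt0n //.
  rewrite lerBlDr -natrX -natrM -natrD ler_nat addnC -mulnDr.
  exact: collisions_le.
(* No mass is lost on [S] x [B]: for [b] in [B], every pair of [L] sends [b] into [S]. *)
have sumN : \sum_(x in setX S B) N x = #|L|%:R * #|B|%:R.
  rewrite exchange_big /= mulr_natl -sumr_const.
  apply: eq_bigr => -[a d] /setXP[/= Aa Dd].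
  rewrite (eq_bigl (fun x => (x.1 \in S) && (x.2 \in B))) => [|x];
    last by rewrite inE.
  rewrite -(pair_big (fun s => s \in S) (fun b => b \in B)
    (fun s b => (a *m (b + d) == s)%:R)) /=.
  rewrite exchange_big /= -sumr_const; apply: eq_bigr => b Bb.
  have Sx : a *m (b + d) \in S.
    rewrite inE; apply/existsP; exists a; rewrite Aa; apply/existsP; exists b.
    by rewrite Bb; apply/existsP; exists d; rewrite Dd eqxx.
  rewrite (bigD1 _ Sx) /= eqxx big1 ?addr0 // => s /andP[_].
  by rewrite eq_sym => /negPf ->.
have := sqr_sum_le (mem (setX S B)) (fun x => N x - mu).
rewrite sumrB sumN sumr_const -[mu *+ _]mulr_natl.
have : \sum_(x in setX S B) (N x - mu) ^+ 2 <= \sum_x (N x - mu) ^+ 2.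
  rewrite [leRHS](bigID (mem (setX S B))) /= lerDl.
  by apply: sumr_ge0 => x _; apply: sqr_ge0.
move=> /le_trans /(_ var) /(ler_wpM2l (ler0n _ #|setX S B|)) h1 /le_trans /(_ h1).
rewrite cardsX [(#|S| * _)%:R]natrM [(2 * _)%:R]natrM => h.
have : (#|F| ^ 4)%:R <= 2 * #|S|%:R :> rat.
  apply: (le_of_second_moment muE _ _ _ h); rewrite ?ler0n //.
    by rewrite ltr0n expn_gt0 q_gt0.
  rewrite -!natrM ler_nat -mulnA -expnD (leq_trans hABD) // cardsX.
  by rewrite mulnAC.
by rewrite -natrM ler_nat.
Qed.

Theorem theorem1p12 (R : realType) :
  exists C c : R, [/\ 0 < C, 0 < c &
    forall (F : finFieldType) (A B D : {set 'M[F]_2}),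
      C * #|F|%:R ^+ 11 <= #|A|%:R * #|B|%:R * #|D|%:R ->
      c * #|F|%:R ^+ 4 <= #|mul_sumset A B D|%:R].
Proof.
(* The 8 is twice the 4 of [card_mul_sumset], since restricting [A] to its invertible elements may
   halve it. *)
exists 8, (1 / 2); split=> [||F A B D]; [by lra..|].
rewrite -natrX -!natrM ler_nat => hABD.
set A' := [set a in A | a \in unitmx].
have q_gt0 : (0 < #|F|)%N by rewrite (leq_trans _ (card_finNzRing_gt1 F)).
(* Since |B||D| is at most q^8, [A] must be large enough for its at most 2 q^3 singular elements to
   be a minority. *)
have leA : (8 * #|F| ^ 3 <= #|A|)%N.
  have lt0 : (0 < #|F| ^ 8)%N by rewrite expn_gt0 q_gt0.
  rewrite -(leq_pmul2r lt0) -mulnA -expnD (leq_trans hABD) // -mulnA leq_mul2l.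
  have le4 (X : {set 'M[F]_2}) : (#|X| <= #|F| ^ 4)%N.
    by rewrite (leq_trans (max_card _)) // card_mx.
  by rewrite (expnD _ 4 4) leq_mul ?le4 ?orbT.
have leA' : (#|A| <= 2 * #|A'|)%N.
  have cardA : (#|A| = #|A'| + #|A :\: [set a | a \in unitmx]|)%N.
    rewrite -(cardsID [set a | a \in unitmx] A); congr addn.
    by apply: eq_card => a; rewrite !inE.
  have : (#|A :\: [set a | a \in unitmx]| <= 2 * #|F| ^ 3)%N.
    apply: leq_trans (card_singular_mx2 F); apply/subset_leq_card/subsetP => a.
    by rewrite !inE => /andP[].
  by lia.
have : (#|F| ^ 4 <= 2 * #|mul_sumset A' B D|)%N.
  apply: card_mul_sumset => [a|]; first by rewrite !inE => /andP[].
  rewrite -(@leq_pmul2l 2) // mulnA (leq_trans hABD) // !mulnA.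
  by rewrite !leq_mul.
have : (#|mul_sumset A' B D| <= #|mul_sumset A B D|)%N.
  apply/subset_leq_card/subsetP => x.
  rewrite !inE => /existsP[a /andP[]]; rewrite inE => /andP[Aa _] h.
  by apply/existsP; exists a; rewrite Aa.
move=> le1 le2.
have : (#|F| ^ 4)%:R <= (2 * #|mul_sumset A B D|)%:R :> R.
  by rewrite ler_nat (leq_trans le2) // leq_mul2l le1.
by rewrite natrX natrM; lra.
Qed.
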